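(* There exist simple matroids $P,Q$ of rank five with \[ \mathcal G(P)=\mathcal G(Q),\qquad H_P^0(q)=H_Q^0(q), \] but \[ H_{\beta,P}(q)=1+9q+30q^2+25q^3+8q^4+q^5,\qquad H_{\beta,Q}(q)=1+9q+28q^2+25q^3+8q^4+q^5. \] In both cases \[ H_P^0(q)=H_Q^0(q)=1+8q+25q^2+25q^3+8q^4+q^5. \]
   Context: Let $M$ be a simple matroid of rank $r$ on a finite ground set $E$, and let $L=L(M)$ be its lattice of flats, a geometric lattice with rank function $\mathrm{rk}$, bottom $\hat 0$, top $\hat 1$, and atom set $A$ (identified with $E$). $L_k$ is the set of flats of rank $k$. $\mathbb R[L]$ is the real vector space with basis $(e_x)_{x\in L}$. For an atom $a$, the linear operator $L_a$ on $\mathbb R[L]$ is $L_ae_x=e_{x\vee a}$ if $a\not\le x$, and $L_ae_x=0$ if $a\le x$. For $x\in L_k$, $\beta_x$ is the number of ordered atom bases of $x$, i.e. of tuples $(a_1,\dots,a_k)\in A^k$ with $a_1\vee\dots\vee a_k=x$ (so $\beta_{\hat 0}=1$). Put $v_k=\sum_{x\in L_k}\beta_xe_x$; in particular $v_r=\beta_{\hat 1}e_{\hat 1}$. Equip $\mathbb R[L]$ with the inner product $\langle e_x,e_y\rangle_\beta=\delta_{x,y}/\beta_x$ and let $L_a^\beta$ be the adjoint of $L_a$ for it. Put $U^\beta=\sum_{a\in A}L_a^\beta$, $Ke_x=\mathrm{rk}(x)e_x$, $s(x)=|A|-|\{a\in A:a\le x\}|$, and $S^{-1}e_x=s(x)^{-1}e_x$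 for $x<\hat 1$, $S^{-1}e_{\hat 1}=0$. Define $D_\beta=S^{-1}U^\beta K$. Define $\mathcal C_0^\beta(M)=\mathbb R v_r$ and $\mathcal C_{k+1}^\beta(M)=D_\beta\mathcal C_k^\beta(M)+\sum_{a\in A}L_a^\beta\mathcal C_k^\beta(M)$; put $h_k^\beta(M)=\dim\mathcal C_k^\beta(M)$ and $H_{\beta,M}(q)=\sum_{k=0}^rh_k^\beta(M)q^k$. Define $\mathcal C_k^0(M)=\mathrm{span}\{L_{a_k}^\beta\cdots L_{a_1}^\beta v_r:a_1,\dots,a_k\in E\}$, $h_k^0(M)=\dim\mathcal C_k^0(M)$ and $H_M^0(q)=\sum_{k=0}^rh_k^0(M)q^k$. The Derksen $\mathcal G$-invariant of a matroid $M$ on an $n$-element set $E$ with rank function $r_M$ is the formal sum $\mathcal G(M)=\sum_\pi[\rho(\pi)]$ over all $n!$ orderings $\pi=(e_1,\dots,e_n)$ of $E$, in the free abelian group on $0/1$-sequences of length $n$, where $\rho(\pi)$ has $i$-th entry $r_M(\{e_1,\dots,e_i\})-r_M(\{e_1,\dots,e_{i-1}\})$. *)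

(* Defs.v *)
From HB Require Import structures.
From mathcomp Require Import all_boot all_order all_algebra.
From mathcomp.multinomials Require Import freeg.
From mathcomp Require Import reals.

Set Implicit Arguments.
Unset Strict Implicit.
Unset Printing Implicit Defensive.

Import Order.TTheory GRing.Theory Num.Theory.

Local Open Scope ring_scope.

Record matroid (E : finType) := Matroid {
  mrank :> {set E} -> nat;
  mrank_card : forall X, (mrank X <= #|X|)%N;
  mrankS : forall X Y : {set E}, X \subset Y -> (mrank X <= mrank Y)%N;
  mrankUI : forall X Y : {set E},
    (mrank (X :|: Y) + mrank (X :&: Y) <= mrank X + mrank Y)%N
}.

Definition rank_of (E : finType) (M : matroid E) : nat := M [set: E].

(* No loops and no parallel pairs. *)
Definition simple_matroid (E : finType) (M : matroid E) : Prop :=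
  (forall a : E, M [set a] = 1%N) /\
  (forall a b : E, a != b -> M [set a; b] = 2%N).

Definition closure (E : finType) (M : matroid E) (X : {set E}) : {set E} :=
  [set e | M (e |: X) == M X].

Section Closure.
Variables (E : finType) (M : matroid E).
Implicit Types X Y : {set E}.

Lemma mrankU_eq X Y : {in Y, forall e, M (e |: X) = M X} -> M (X :|: Y) = M X.
Proof.
rewrite -[Y]set_enum => H.
have {H}: {in enum Y, forall e, M (e |: X) = M X}.
  by move=> e eY; apply: H; rewrite inE.
elim: (enum Y) => [|e s IHs] H; first by rewrite set_nil setU0.
have IH : M (X :|: [set x in s]) = M X.
  by apply: IHs => x xs; apply: H; rewrite inE xs orbT.
have He : M (e |: X) = M X by apply: H; rewrite mem_head.
apply/eqP; rewrite eqn_leq (mrankS _ (subsetUl _ _)) andbT.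
have := mrankUI M (X :|: [set x in s]) (e |: X).
rewrite IH He => H1.
have H2 : (M X <= M ((X :|: [set x in s]) :&: (e |: X)))%N.
  by apply: mrankS; rewrite subsetI subsetUl subsetUr.
have -> : X :|: [set x in e :: s] = (X :|: [set x in s]) :|: (e |: X).
  by apply/setP => x; rewrite !inE; case: (x \in X); case: (x == e);
     rewrite ?orbT ?orbF.
rewrite -(leq_add2r (M X)); apply: leq_trans H1.
by rewrite leq_add2l.
Qed.

Lemma sub_closure X : X \subset closure M X.
Proof. by apply/subsetP => e eX; rewrite inE (setUidPr _) // sub1set. Qed.

Lemma mrank_closure X : M (closure M X) = M X.
Proof.
rewrite -{1}(setUidPr (sub_closure X)); apply: mrankU_eq => e.
by rewrite inE => /eqP.
Qed.

Lemma closureS X Y : X \subset Y -> closure M X \subset closure M Y.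
Proof.
move=> sXY; apply/subsetP => e; rewrite !inE => /eqP eX.
rewrite eqn_leq (mrankS _ (subsetUr _ _)) andbT.
have := mrankUI M Y (e |: X); rewrite eX => H1.
have H2 : (M X <= M (Y :&: (e |: X)))%N.
  by apply: mrankS; rewrite subsetI sXY subsetUr.
have <- : Y :|: (e |: X) = e |: Y.
  by rewrite setUCA (setUidPl sXY).
by rewrite -(leq_add2r (M X)); apply: leq_trans H1; rewrite leq_add2l.
Qed.

Lemma closureK X : closure M (closure M X) = closure M X.
Proof.
apply/eqP; rewrite eqEsubset sub_closure andbT.
apply/subsetP => e; rewrite [in X in X -> _]inE mrank_closure inE => /eqP eX.
rewrite eqn_leq (mrankS _ (subsetUr _ _)) andbT -[X in (_ <= X)%N]eX.
by apply: mrankS; apply: setUS; apply: sub_closure.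
Qed.

Lemma closure_eq X Y : X \subset Y -> M X = M Y -> closure M X = closure M Y.
Proof.
move=> sXY eXY; apply/eqP; rewrite eqEsubset closureS //=.
rewrite -(closureK X); apply: closureS.
apply/subsetP => e eY; rewrite inE eqn_leq (mrankS _ (subsetUr _ _)) andbT.
by rewrite eXY; apply: mrankS; rewrite subUset sub1set eY.
Qed.

Lemma exists_basis X :
  exists2 t : (M X).-tuple E, [set x in t] \subset X & M [set x in t] = M X.
Proof.
suff: forall k, (k <= M X)%N ->
    exists2 t : k.-tuple E, [set x in t] \subset X & M [set x in t] = k.
  by apply.
elim=> [|k IHk] kX.
  exists [tuple]; first by rewrite set_nil sub0set.
  by apply/eqP; rewrite set_nil -leqn0 -(cards0 E) mrank_card.
have [t tX rt] := IHk (ltnW kX).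
have [e eX rte] : exists2 e, e \in X & M (e |: [set x in t]) != M [set x in t].
  apply/exists_inP; rewrite -[X in is_true X]negbK negb_exists_in.
  apply/negP => /forall_inP H.
  have /mrankU_eq : {in X, forall e, M (e |: [set x in t]) = M [set x in t]}.
    by move=> e /H; rewrite negbK => /eqP.
  by rewrite (setUidPr tX) rt => rX; rewrite rX ltnn in kX.
exists [tuple of e :: t]; first by rewrite set_cons subUset sub1set eX.
rewrite set_cons; apply/eqP; rewrite eqn_leq; apply/andP; split.
  have := mrankUI M [set e] [set x in t]; rewrite rt => H.
  apply: leq_trans (leq_trans (leq_addr _ _) H) _.
  by rewrite -add1n leq_add2r -(cards1 e) mrank_card.
by rewrite -[in X in (X < _)%N]rt ltn_neqAle eq_sym rte mrankS // subsetUr.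
Qed.

End Closure.

Record flat (E : finType) (M : matroid E) := Flat {
  flat_set :> {set E};
  flatP : closure M flat_set == flat_set
}.

Section FlatLattice.
Variables (E : finType) (M : matroid E).
Implicit Types x y z : flat M.

HB.instance Definition _ := [isSub for @flat_set E M].
HB.instance Definition _ := [Finite of flat M by <:].

Definition flat_le x y := flat_set x \subset flat_set y.

Fact flat_le_refl : reflexive flat_le.
Proof. by move=> x; apply: subxx. Qed.

Fact flat_le_anti : antisymmetric flat_le.
Proof. by move=> x y; rewrite /flat_le -eqEsubset => /eqP /val_inj. Qed.

Fact flat_le_trans : transitive flat_le.
Proof. by move=> y x z; apply: subset_trans. Qed.

HB.instance Definition _ := Order.Le_isPOrder.Build (Order.Disp tt tt) (flat M)
  flat_le_refl flat_le_anti flat_le_trans.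

Definition flat_closure (X : {set E}) : flat M :=
  @Flat E M (closure M X) (introT eqP (closureK M X)).

Fact flat_meet_subproof x y : closure M (x :&: y) == x :&: y.
Proof.
rewrite eqEsubset sub_closure andbT subsetI -{2}(eqP (flatP x)).
by rewrite -{3}(eqP (flatP y)) !closureS ?subsetIl ?subsetIr.
Qed.

Definition flat_meet x y : flat M := Flat (flat_meet_subproof x y).
Definition flat_join x y : flat M := flat_closure (x :|: y).

Lemma flat_closure_le X x : (flat_closure X <= x)%O = (X \subset x).
Proof.
apply/idP/idP => [|sXx]; first exact: subset_trans (sub_closure M X).
by apply: subset_trans (closureS M sXx) _; rewrite (eqP (flatP x)).
Qed.

Fact flat_meetP x y z : (x <= flat_meet y z)%O = (x <= y)%O && (x <= z)%O.
Proof. exact: subsetI. Qed.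

Fact flat_joinP x y z : (flat_join x y <= z)%O = (x <= z)%O && (y <= z)%O.
Proof. by rewrite flat_closure_le subUset. Qed.

HB.instance Definition _ := Order.POrder_MeetJoin_isLattice.Build
  (Order.Disp tt tt) (flat M) flat_meetP flat_joinP.

Fact flat_top_subproof : closure M [set: E] == [set: E].
Proof. by rewrite -subTset sub_closure. Qed.

Fact flat_le0x x : (flat_closure set0 <= x)%O.
Proof. by rewrite flat_closure_le sub0set. Qed.

Fact flat_lex1 x : (x <= Flat flat_top_subproof)%O.
Proof. exact: subsetT. Qed.

HB.instance Definition _ :=
  Order.hasBottom.Build (Order.Disp tt tt) (flat M) flat_le0x.
HB.instance Definition _ :=
  Order.hasTop.Build (Order.Disp tt tt) (flat M) flat_lex1.

(* For simple M, [atom] is a bijection from E onto the atoms of the lattice,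
   and sums over the atom set are written as sums over E. *)
Definition atom (a : E) : flat M := flat_closure [set a].

Definition rk x : nat := M x.

Definition beta x : nat :=
  #|[set t : (rk x).-tuple E | (\join_(a <- t) atom a)%O == x]|.

Lemma atom_le a x : (atom a <= x)%O = (a \in flat_set x).
Proof. by rewrite flat_closure_le sub1set. Qed.

Lemma join_atoms (s : seq E) :
  (\join_(a <- s) atom a)%O = flat_closure [set a in s].
Proof.
apply/eqP; rewrite eq_le; apply/andP; split.
  apply/joinsP_seq => a a_s _; rewrite atom_le; apply: subsetP (sub_closure _ _) _ _.
  by rewrite inE.
rewrite flat_closure_le; apply/subsetP => a; rewrite inE => a_s.
by rewrite -atom_le; apply: (joins_sup_seq atom a_s).
Qed.

Lemma beta_gt0 x : (0 < beta x)%N.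
Proof.
have [t tx rt] := exists_basis M x.
apply/card_gt0P; exists t; rewrite inE join_atoms -val_eqE /=.
by rewrite (closure_eq tx rt) (eqP (flatP x)).
Qed.

End FlatLattice.

(* R^o is R viewed as a one-dimensional vector space over itself. *)
Notation chains R M := {ffun flat M -> R^o}.

Section Operators.
Variables (R : numFieldType) (E : finType) (M : matroid E).
Implicit Types (x y : flat M) (a : E) (u v : chains R M).

Definition delta x : chains R M := [ffun y => (y == x)%:R].

Definition extend_fun (f : flat M -> chains R M) u : chains R M :=
  \sum_x u x *: f x.

Fact extend_is_linear f : linear (extend_fun f).
Proof.
move=> c u v; rewrite /extend_fun scaler_sumr -big_split.
by apply: eq_bigr => x _; rewrite !ffunE scalerDl scalerA.
Qed.

HB.instance Definition _ f := GRing.isLinear.Build R (chains R M) (chains R M)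
  *:%R (extend_fun f) (extend_is_linear f).

Definition extend (f : flat M -> chains R M) : 'End(chains R M) :=
  linfun (extend_fun f).

Lemma extend_delta f x : extend f (delta x) = f x.
Proof.
rewrite lfunE /= /extend_fun (bigD1 x) //= ffunE eqxx scale1r big1 ?addr0 //.
by move=> y /negPf yx; rewrite ffunE yx scale0r.
Qed.

Lemma chains_sum_delta u : u = \sum_x u x *: delta x.
Proof.
apply/ffunP => y; rewrite sum_ffunE (bigD1 y) //= !ffunE eqxx.
rewrite big1 ?addr0 => [|x xy]; first by rewrite /GRing.scale /= mulr1.
by rewrite !ffunE eq_sym (negPf xy) /GRing.scale /= mulr0.
Qed.

Definition raise a : 'End(chains R M) :=
  extend (fun x => if (atom M a <= x)%O then 0 else delta (x `|` atom M a)%O).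

Definition dot_beta u v : R := \sum_x u x * v x / (beta x)%:R.

(* The coefficient of e_x in the adjoint of f applied to e_y is
   <f e_x, e_y> / <e_x, e_x>; see [dot_beta_adjoint] and [adjoint_unique]. *)
Definition adjoint (f : 'End(chains R M)) : 'End(chains R M) :=
  extend (fun y =>
    [ffun x => dot_beta (f (delta x)) (delta y) / dot_beta (delta x) (delta x)]).

Lemma dot_delta_l x u : dot_beta (delta x) u = u x / (beta x)%:R.
Proof.
rewrite /dot_beta (bigD1 x) //= ffunE eqxx mul1r big1 ?addr0 //.
by move=> y /negPf yx; rewrite ffunE yx !mul0r.
Qed.

Lemma dot_betaC u v : dot_beta u v = dot_beta v u.
Proof. by apply: eq_bigr => x _; rewrite [u x * _]mulrC. Qed.

Lemma dot_suml (I : finType) (c : I -> R) (w : I -> chains R M) v :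
  dot_beta (\sum_i c i *: w i) v = \sum_i c i * dot_beta (w i) v.
Proof.
under [RHS]eq_bigr do rewrite mulr_sumr.
rewrite exchange_big; apply: eq_bigr => x _ /=.
rewrite sum_ffunE !mulr_suml; apply: eq_bigr => i _.
by rewrite ffunE /GRing.scale /= !mulrA.
Qed.

Lemma dot_beta_adjoint (f : 'End(chains R M)) u v : dot_beta (f u) v = dot_beta u (adjoint f v).
Proof.
have bn0 x : (beta x)%:R != 0 :> R by rewrite pnatr_eq0 -lt0n beta_gt0.
rewrite [u in LHS]chains_sum_delta linear_sum /=.
under eq_bigr do rewrite linearZ /=.
rewrite dot_suml [u in RHS]chains_sum_delta dot_suml.
apply: eq_bigr => x _; congr (_ * _).
rewrite dot_delta_l lfunE /= /extend_fun sum_ffunE mulr_suml.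
rewrite [v in LHS]chains_sum_delta dot_betaC dot_suml.
apply: eq_bigr => y _; rewrite !ffunE /GRing.scale /= -mulrA; congr (_ * _).
rewrite dot_betaC (dot_delta_l x) ffunE eqxx mul1r invrK.
by rewrite mulfK.
Qed.

Lemma adjoint_unique (f g : 'End(chains R M)) :
  (forall u v, dot_beta (f u) v = dot_beta u (g v)) -> g = adjoint f.
Proof.
move=> fg; apply/lfunP => v; apply/ffunP => x.
have := dot_beta_adjoint f (delta x) v; rewrite fg !dot_delta_l.
by apply: mulIf; rewrite invr_eq0 pnatr_eq0 -lt0n beta_gt0.
Qed.

Definition lower a : 'End(chains R M) := adjoint (raise a).

Definition vlevel (k : nat) : chains R M :=
  \sum_(x : flat M | rk x == k) (beta x)%:R *: delta x.

Definition U_beta : 'End(chains R M) := \sum_a lower a.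

Definition K_op : 'End(chains R M) := extend (fun x => (rk x)%:R *: delta x).

Definition s_fun x : nat := (#|E| - #|[set a | (atom M a <= x)%O]|)%N.

Definition S_inv : 'End(chains R M) :=
  extend (fun x => if x == \top%O then 0 else (s_fun x)%:R^-1 *: delta x).

Definition D_beta : 'End(chains R M) := (S_inv \o U_beta \o K_op)%VF.

Fixpoint C_beta (k : nat) : {vspace chains R M} :=
  if k is j.+1
  then (D_beta @: C_beta j + \sum_(a : E) (lower a @: C_beta j))%VS
  else <[vlevel (rank_of M)]>%VS.

(* For t = (a_1, ..., a_k) the left fold is L_{a_k} ... L_{a_1} v_r. *)
Definition C_zero (k : nat) : {vspace chains R M} :=
  span [seq foldl (fun u a => lower a u) (vlevel (rank_of M)) t
       | t : k.-tuple E].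

End Operators.

Definition h_beta (R : numFieldType) (E : finType) (M : matroid E) k : nat :=
  \dim (C_beta R M k).

Definition h_zero (R : numFieldType) (E : finType) (M : matroid E) k : nat :=
  \dim (C_zero R M k).

Definition H_beta (R : numFieldType) (E : finType) (M : matroid E) : {poly int} :=
  \sum_(k < (rank_of M).+1) (h_beta R M k)%:R *: 'X^k.

Definition H_zero (R : numFieldType) (E : finType) (M : matroid E) : {poly int} :=
  \sum_(k < (rank_of M).+1) (h_zero R M k)%:R *: 'X^k.

Definition rank_jumps (E : finType) (M : matroid E) (s : seq E) : seq nat :=
  [seq (M [set e in take i.+1 s] - M [set e in take i s])%N
  | i <- iota 0 (size s)].

(* Orderings of E are the duplicate-free #|E|-tuples.  The invariants of
   matroids on different ground sets are compared in the free abelian group on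
   all sequences of naturals, which contains those on 0/1-sequences of each
   fixed length. *)
Definition G_invariant (E : finType) (M : matroid E) : {freeg (seq nat)} :=
  \sum_(p : #|E|.-tuple E | uniq p) << rank_jumps M p >>.

(* Main.v *)
From Stdlib Require Import ZArith.
From mathcomp Require Import all_boot all_order all_algebra.
From mathcomp Require Import ssrZ ring.
From mathcomp.multinomials Require Import freeg.
From mathcomp Require Import reals.
Require Import Defs.

(** Both matroids live on eight elements and are duals of a rank 3 point-line
configuration with repeated points: six points, two lines of three points, two
points doubled.  For [P] the two lines are disjoint and one point of each is
doubled; for [Q] the lines share a doubled point, and the other doubled point
lies on neither line.  The rest is a finite computation, made feasible by
three observations.

Write a chain as [\sum_x beta x * w x *: delta x].  In the coordinate [w] the
adjoint of [raise a] sends [w] to the function equal to [w (x `|` atom a)] if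
[a] is outside [x] and to 0 otherwise, and the value of [D_beta w] at
a proper flat [x] is the average of [rk (x `|` atom a) * w (x `|` atom a)] over
the [a] outside [x] ([lowerE], [D_betaE]).  So the numbers [beta x] disappear,
and clearing the denominators [s_fun x] turns all operators into sparse integer
matrices indexed by the flats ([vec_lower], [vec_D]).

The subspaces of both filtrations arise by applying a fixed list of operators
again and again ([C_zeroS] and the definition of [C_beta]).  Integer Gaussian
elimination replaces each spanning family by a basis before the next step
([echelonP]), and since the elimination is valid over every field of
characteristic 0 the sizes of these bases are the dimensions over the given
real field ([dim_levels]).

Once the elements of a set [X] have been listed, the jumps that can still
follow depend on [X] alone and not on the order of its elements.  So the jump
sequences of the [8`! = 40320] orderings are counted by a recursion over the 256
subsets ([sum_rank_jumps]).  For both matroids the same five sequences occur,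
with the same multiplicities. *)

Set Implicit Arguments.
Unset Strict Implicit.
Unset Printing Implicit Defensive.

Import Order.TTheory GRing.Theory Num.Theory.

Local Open Scope ring_scope.

(** * Integer Gaussian elimination *)

(** A list stands for the infinite sequence that continues it by zeros. *)
Definition entry (v : seq Z) (i : nat) : Z := nth 0 v i.

Fixpoint comb (a : Z) (v : seq Z) (b : Z) (w : seq Z) : seq Z :=
  match v, w with
  | x :: v', y :: w' => Z.sub (Z.mul a x) (Z.mul b y) :: comb a v' b w'
  | [::], _ => [seq Z.opp (Z.mul b y) | y <- w]
  | _, [::] => [seq Z.mul a x | x <- v]
  end.

Lemma entry_comb a v b w i :
  entry (comb a v b w) i = a * entry v i - b * entry w i.
Proof.
rewrite /entry; elim: v w i => [|x v IHv] [|y w] [|i] //=;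
  rewrite ?nth_nil ?mulr0 ?subr0 ?sub0r //.
- case: (ltnP i (size w)) => iw; first by rewrite (nth_map 0).
  by rewrite !nth_default ?size_map // mulr0 oppr0.
- case: (ltnP i (size v)) => iv; first by rewrite (nth_map 0).
  by rewrite !nth_default ?size_map // mulr0.
Qed.

(** Dividing both multipliers by the gcd of the two pivot entries keeps the
integers short; without it their lengths can double at each step. *)
Definition reduce (p : nat) (v w : seq Z) : seq Z :=
  if Z.eqb (entry w p) Z0 then w else
  let: (a, b) := (Z.ggcd (entry v p) (entry w p)).2 in comb a w b v.

Lemma reduceP p v w : entry v p != 0 ->
  exists a b, [/\ a != 0,
    forall i, entry (reduce p v w) i = a * entry w i - b * entry v i
    & entry (reduce p v w) p = 0].
Proof.
move=> vp; rewrite /reduce; case: ifP => [/eqP wp|wp].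
  by exists 1, 0; split=> // i; rewrite mul1r mul0r subr0.
have := Z.ggcd_correct_divisors (entry v p) (entry w p).
case: (Z.ggcd _ _) => g [a b] /= [va wb].
have {}va : entry v p = g * a by [].
have {}wb : entry w p = g * b by [].
exists a, b; split=> [|i|]; rewrite ?entry_comb //.
  by apply: contraNneq vp => a0; rewrite va a0 mulr0.
by rewrite va wb; ring.
Qed.

Definition pivot (v : seq Z) : nat := find (fun c => ~~ Z.eqb c Z0) v.

Lemma pivot_entry v i : (i < pivot v)%N -> entry v i = 0.
Proof. by move=> /(before_find 0) /negbFE/eqP. Qed.

(** The fuel [k] bounds the number of rows.  Rows whose pivot is not among the
first [n] entries represent the zero vector and are dropped. *)
Fixpoint echelon_rec (n k : nat) (vs : seq (seq Z)) : seq (seq Z) :=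
  if k isn't k'.+1 then [::] else
  if vs isn't v :: vs' then [::] else
  if (pivot v < minn n (size v))%N
  then v :: echelon_rec n k' [seq reduce (pivot v) v w | w <- vs']
  else echelon_rec n k' vs'.

Definition echelon n vs := echelon_rec n (size vs) vs.

(** The coordinates of the vectors are the elements of a finite type [T],
listed by [pos] at the positions below [n] and rescaled by [wt]. *)
Section Elimination.
Variables (R : numFieldType) (T : finType) (wt : T -> R) (pos : T -> nat).
Variable n : nat.
Hypothesis wt_neq0 : forall x, wt x != 0.
Hypothesis pos_lt : forall x, (pos x < n)%N.
Hypothesis pos_onto : forall p, (p < n)%N -> exists x, pos x = p.

Local Notation V := {ffun T -> R^o}.
Local Notation toR z := ((int_of_Z z)%:~R : R).

Definition vec (v : seq Z) : V := [ffun x => wt x * toR (entry v (pos x))].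

Lemma toR_eq0 z : (toR z == 0) = (z == 0).
Proof. by rewrite intr_eq0 -[0]/(int_of_Z 0) (can_eq int_of_ZK). Qed.

Lemma vec_comb (a b : Z) u v w :
  (forall i, entry u i = a * entry w i - b * entry v i) ->
  vec u = toR a *: vec w - toR b *: vec v.
Proof.
move=> e; apply/ffunP => x.
by rewrite !ffunE e !(rmorphB, rmorphM) /GRing.scale /= mulrBr !(mulrCA (wt x)).
Qed.

Lemma addv_line_comb (u w : V) (a b : R) : a != 0 ->
  (<[u]> + <[a *: w - b *: u]> = <[u]> + <[w]>)%VS.
Proof.
move=> a0; have ul (W : {vspace V}) c : c *: u \in (<[u]> + W)%VS.
  by rewrite rpredZ // (subvP (addvSl _ _)) // memv_line.
have lr (W : {vspace V}) (x : V) : x \in (W + <[x]>)%VS.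
  by rewrite (subvP (addvSr _ _)) // memv_line.
apply/eqP; rewrite eqEsubv !subv_add !addvSl /= -!memvE; apply/andP; split.
  by rewrite rpredB ?ul // rpredZ ?lr.
rewrite -[X in X \in _](scalerK a0) rpredZ //.
by rewrite -[X in X \in _](subrK (b *: u)) rpredD ?ul ?lr.
Qed.

Lemma span_reduce v ws p : entry v p != 0 ->
  (<[vec v]> + <<[seq vec (reduce p v w) | w <- ws]>> =
   <[vec v]> + <<[seq vec w | w <- ws]>>)%VS.
Proof.
move=> vp; elim: ws => //= w ws IHws; rewrite !span_cons addvA.
have [a [b [a0 /vec_comb -> _]]] := reduceP w vp.
rewrite addv_line_comb ?toR_eq0 // [(_ + <[vec w]>)%VS]addvC -addvA IHws.
by rewrite addvA [RHS]addvA [(<[vec w]> + _)%VS]addvC.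
Qed.

Lemma span_vanish (us : seq V) x u :
  {in us, forall w : V, w x = 0} -> u \in <<us>>%VS -> u x = 0.
Proof.
move=> us0 uS; rewrite (coord_span (X := in_tuple us) uS) sum_ffunE.
rewrite big1 // => i _.
by rewrite ffunE us0 ?scaler0 // mem_nth.
Qed.

(** After reduction all later rows vanish at the pivot of the first row, hence
so does their span, which therefore misses the first row. *)
Lemma echelonP vs :
  <<map vec (echelon n vs)>>%VS = <<map vec vs>>%VS /\
  free (map vec (echelon n vs)).
Proof.
rewrite /echelon; move: {-1}(size vs) (leqnn (size vs)) => k.
elim: k vs => [|k IHk] [|v vs] //= lek; rewrite ?nil_free //.
rewrite leq_min; case: ifP => [/andP[pn pv]|npiv].
  have {}pv : entry v (pivot v) != 0.
    by move: pv; rewrite -has_find => /(nth_find 0).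
  have [|eqS freeS] := IHk [seq reduce (pivot v) v w | w <- vs].
    by rewrite size_map.
  rewrite /= !span_cons eqS -map_comp span_reduce //; split=> //.
  rewrite free_cons freeS andbT eqS; apply/negP => vS.
  have [x posx] := pos_onto pn.
  have : vec v x = 0.
    apply: span_vanish vS => _ /mapP[_ /mapP[w _ ->] ->].
    have [a [b [_ _ r0]]] := reduceP w pv.
    by rewrite ffunE posx r0 mulr0.
  by apply/eqP; rewrite ffunE posx mulf_neq0 // toR_eq0.
have [-> ->] := IHk vs lek; split=> //; rewrite span_cons.
suff -> : vec v = 0 by rewrite add0v.
apply/ffunP => x; rewrite !ffunE.
have -> : entry v (pos x) = 0; last by rewrite mulr0.
case: (ltnP (pos x) (pivot v)) => [/pivot_entry // | px].
rewrite /entry nth_default //; apply: leq_trans (px).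
by move: npiv; rewrite (leq_ltn_trans px (pos_lt x)) /= ltnNge => /negbFE.
Qed.

End Elimination.

(** * Iterated images of a line under integer matrices *)

(** A row is a list of pairs of a coefficient and a column. *)
Definition sparse_mx := seq (seq (Z * nat)).

Definition row_dot (row : seq (Z * nat)) (v : seq Z) : Z :=
  foldr (fun t acc => Z.add (Z.mul t.1 (entry v t.2)) acc) Z0 row.

Definition apply_mx (m : sparse_mx) (v : seq Z) : seq Z :=
  [seq row_dot row v | row <- m].

Definition next_basis n (ms : seq sparse_mx) (B : seq (seq Z)) : seq (seq Z) :=
  echelon n [seq apply_mx m v | m <- ms, v <- B].

Lemma span_scaled (R : numFieldType) (V : vectType R) (I : Type) (c : R)
    (g h : I -> V) (s : seq I) :
  c != 0 -> (forall i, g i = c *: h i) -> <<map g s>>%VS = <<map h s>>%VS.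
Proof.
move=> c0 gh; elim: s => //= i s IHs; rewrite !span_cons IHs gh; congr (_ + _)%VS.
apply/eqP; rewrite eqEsubv -!memvE rpredZ ?memv_line //=.
by rewrite -[X in X \in _](scalerK c0) rpredZ // memv_line.
Qed.

Section Iteration.
Variables (R : numFieldType) (T : finType) (wt : T -> R) (pos : T -> nat).
Variable n : nat.
Hypothesis wt_neq0 : forall x, wt x != 0.
Hypothesis pos_lt : forall x, (pos x < n)%N.
Hypothesis pos_onto : forall p, (p < n)%N -> exists x, pos x = p.

Local Notation V := {ffun T -> R^o}.
Local Notation vec := (vec wt pos).

(** The scalar [c] is there to clear the denominators of the operator; it does
not change the image. *)
Variables (J : Type) (s : seq J) (f : J -> 'End(V)) (m : J -> sparse_mx).
Hypothesis mP : forall j, exists2 c, c != 0 &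
  forall v, vec (apply_mx (m j) v) = c *: f j (vec v).

Lemma span_next_basis B :
  (<<map vec (next_basis n (map m s) B)>> =
   \sum_(j <- s) f j @: <<map vec B>>)%VS.
Proof.
have [-> _] := echelonP wt_neq0 pos_lt pos_onto
                 [seq apply_mx m v | m <- map m s, v <- B].
elim: s => [|j s' IHs]; rewrite ?big_nil ?span_nil // big_cons /=.
rewrite map_cat span_cat IHs; congr (_ + _)%VS.
rewrite limg_span -!map_comp; have [c c0 mj] := mP j.
exact: span_scaled c0 _.
Qed.

Variables (W : nat -> {vspace V}) (v0 : seq Z).
Hypothesis W0 : W 0%N = <[vec v0]>%VS.
Hypothesis WS : forall k, W k.+1 = (\sum_(j <- s) f j @: W k)%VS.

(** Passing to a basis at every level keeps the number of generators bounded,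
whereas the words in the operators multiply by [size s] at each step. *)
Lemma dim_levels k :
  \dim (W k) = size (iter k (next_basis n (map m s)) (echelon n [:: v0])).
Proof.
set B := iter _ _ _.
suff [<- fB] : <<map vec B>>%VS = W k /\ free (map vec B).
  by rewrite (eqP fB) size_map.
rewrite /B; split; last first.
  by case: k {B} => [|k]; apply: (echelonP wt_neq0 pos_lt pos_onto _).2.
elim: k {B} => [|k IHk] /=.
  have [-> _] := echelonP wt_neq0 pos_lt pos_onto [:: v0].
  by rewrite span_seq1.
by rewrite span_next_basis IHk WS.
Qed.

End Iteration.

(** * The operators on chains of flats *)

Section MatroidOperators.
Variables (R : numFieldType) (E : finType) (M : matroid E).
Implicit Types (x y : flat M) (a : E) (u : chains R M).

Lemma beta_neq0 x : (beta x)%:R != 0 :> R.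
Proof. by rewrite pnatr_eq0 -lt0n beta_gt0. Qed.

(** In the coordinate [u x / beta x] the matrix of [lower] has only the entries
0 and 1. *)
Lemma lowerE a u x : lower R M a u x =
  if a \in flat_set x then 0
  else (beta x)%:R * (u (x `|` atom M a)%O / (beta (x `|` atom M a)%O)%:R).
Proof.
have := dot_beta_adjoint (raise R M a) (delta R x) u.
rewrite dot_delta_l -/(lower R M a) extend_delta atom_le.
case: ifP => [_|_].
  rewrite /dot_beta big1 => [/esym/eqP|y _]; last by rewrite ffunE !mul0r.
  by rewrite mulf_eq0 invr_eq0 (negbTE (beta_neq0 x)) orbF => /eqP.
by rewrite dot_delta_l => ->; rewrite mulrCA divff ?mulr1 ?beta_neq0.
Qed.

Lemma extend_diag (c : flat M -> R) u x :
  extend (fun y => c y *: delta R y) u x = c x * u x.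
Proof.
rewrite lfunE /= /extend_fun sum_ffunE (bigD1 x) //= !ffunE eqxx.
rewrite big1 ?addr0 => [|y yx]; first by rewrite /GRing.scale /= mulr1 mulrC.
by rewrite !ffunE eq_sym (negbTE yx) /GRing.scale /= !mulr0.
Qed.

Lemma D_betaE u x : D_beta R M u x =
  if x == \top%O then 0 else
  (s_fun x)%:R^-1 * \sum_(a | a \notin flat_set x) (beta x)%:R *
    ((rk (x `|` atom M a)%O)%:R * u (x `|` atom M a)%O
      / (beta (x `|` atom M a)%O)%:R).
Proof.
have -> : D_beta R M u =
    extend (fun y => (if y == \top%O then 0 else (s_fun y)%:R^-1) *: delta R y)
      (U_beta R M (K_op R M u)).
  rewrite /D_beta !comp_lfunE /S_inv !lfunE /= /extend_fun; apply: eq_bigr => y _.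
  by case: ifP; rewrite ?scale0r.
rewrite extend_diag; case: ifP => [_|_]; first by rewrite mul0r.
rewrite /U_beta sum_lfunE sum_ffunE; congr (_ * _); rewrite [RHS]big_mkcond /=.
apply: eq_bigr => a _; rewrite lowerE extend_diag.
by case: ifP.
Qed.

Lemma C_zero0 : C_zero R M 0 = <[vlevel R M (rank_of M)]>%VS.
Proof.
rewrite /C_zero; apply/eqP; rewrite eqEsubv; apply/andP; split.
  by apply/span_subvP => _ /imageP[t _ ->]; rewrite tuple0 memv_line.
rewrite -memvE memv_span //; apply/imageP; exists [tuple] => //.
Qed.

(** The last letter of a word is the operator applied last. *)
Lemma C_zeroS k : C_zero R M k.+1 = (\sum_a lower R M a @: C_zero R M k)%VS.
Proof.
apply/eqP; rewrite eqEsubv; apply/andP; split.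
  apply/span_subvP => _ /imageP[t _ ->].
  case: (lastP t) (size_tuple t) => // s a; rewrite size_rcons => -[sk].
  rewrite foldl_rcons; apply: (subvP (sumv_sup a isT (subvv _))).
  rewrite memv_img // memv_span //; apply/imageP.
  by exists (tcast sk (in_tuple s)) => //; rewrite val_tcast.
apply/subv_sumP => a _; rewrite limg_span; apply/span_subvP => _ /mapP[w + ->].
case/imageP => t _ ->; rewrite memv_span //; apply/imageP.
by exists [tuple of rcons t a] => //=; rewrite foldl_rcons.
Qed.

End MatroidOperators.

(** * Subsets as lists of bits *)

Definition bits n (X : {set 'I_n.+1}) : bitseq :=
  mkseq (fun i => inord i \in X) n.+1.

Definition unbits n (b : bitseq) : {set 'I_n.+1} :=
  [set i : 'I_n.+1 | nth false b i].
Arguments unbits : clear implicits.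

Fixpoint bitseqs (n : nat) : seq bitseq :=
  if n is m.+1 then map (cons true) (bitseqs m) ++ map (cons false) (bitseqs m)
  else [:: [::]].

Definition add_bit (b : bitseq) (i : nat) : bitseq := set_nth false b i true.

Definition bits_op (op : bool -> bool -> bool) (b c : bitseq) : bitseq :=
  [seq op p.1 p.2 | p <- zip b c].

Section Bits.
Variable n : nat.
Implicit Types (X Y : {set 'I_n.+1}) (b : bitseq).

Lemma nth_bits X (i : 'I_n.+1) : nth false (bits X) i = (i \in X).
Proof. by rewrite nth_mkseq // inord_val. Qed.

Lemma bitsK : cancel (@bits n) (unbits n).
Proof. by move=> X; apply/setP => i; rewrite inE nth_bits. Qed.

Lemma unbitsK b : size b = n.+1 -> bits (unbits n b) = b.
Proof.
move=> sb; apply: (@eq_from_nth _ false) => [|i]; rewrite size_mkseq // => ltin.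
by rewrite -[i in LHS]/(val (Ordinal ltin)) nth_bits inE.
Qed.

Lemma mem_bitseqs m b : (b \in bitseqs m) = (size b == m).
Proof.
elim: m b => [|m IHm] b /=; first by rewrite inE -size_eq0.
rewrite mem_cat; case: b => [|c b] /=; rewrite ?eqSS -?IHm.
  by apply/negbTE/norP; split; apply/mapP => -[].
have injc d : injective (@cons bool d) by move=> ? ? [].
have ncons d : (~~ d :: b \in map (cons d) (bitseqs m)) = false.
  by apply/mapP => -[? _ []]; case: d.
by case: c; rewrite mem_map // ?(ncons true) ?(ncons false) ?orbF.
Qed.

Lemma uniq_bitseqs m : uniq (bitseqs m).
Proof.
elim: m => //= m IHm; rewrite cat_uniq !map_inj_uniq ?IHm ?andbT /=;
  try by move=> ? ? [].
by apply/hasPn => _ /mapP[b _ ->]; apply/mapP => -[].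
Qed.

Lemma bits_in X : bits X \in bitseqs n.+1.
Proof. by rewrite mem_bitseqs size_mkseq. Qed.

Lemma bitsU1 X (i : 'I_n.+1) : bits (i |: X) = add_bit (bits X) i.
Proof.
rewrite /add_bit; apply: (@eq_from_nth _ false) => [|j].
  by rewrite size_set_nth !size_mkseq (maxn_idPr (ltn_ord i)).
rewrite size_mkseq => ltj; rewrite nth_set_nth /=.
rewrite -[j]/(val (Ordinal ltj)) !nth_bits !inE.
by rewrite -val_eqE /=; case: eqP.
Qed.

Lemma bits_map2 (op : bool -> bool -> bool) X Y :
  bits [set i | op (i \in X) (i \in Y)] =
  bits_op op (bits X) (bits Y).
Proof.
rewrite /bits_op; apply: (@eq_from_nth _ false) => [|i].
  by rewrite size_map size1_zip !size_mkseq.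
rewrite size_mkseq => lti.
rewrite (nth_map (false, false)) ?size1_zip ?size_mkseq //.
by rewrite nth_zip ?size_mkseq //= !nth_mkseq // inE.
Qed.

Lemma bits_const X c : (forall i, (i \in X) = c) -> bits X = nseq n.+1 c.
Proof.
move=> Xc; apply: (@eq_from_nth _ false) => [|i].
  by rewrite size_mkseq size_nseq.
by rewrite size_mkseq => lti; rewrite nth_mkseq // Xc nth_nseq lti.
Qed.

Lemma bits0 : bits (set0 : {set 'I_n.+1}) = nseq n.+1 false.
Proof. by apply: bits_const => i; rewrite inE. Qed.

Lemma bitsT : bits [set: 'I_n.+1] = nseq n.+1 true.
Proof. by apply: bits_const => i; rewrite inE. Qed.

Lemma count_iota (A : {set 'I_n.+1}) :
  count (fun i => inord i \in A) (iota 0 n.+1) = #|A|.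
Proof.
rewrite -val_enum_ord count_map cardE size_filter -enumT; apply: eq_count => i /=.
by rewrite inord_val.
Qed.

End Bits.

(** * The filtrations of a matroid computed from its rank function *)

Section Levels.
Variables (n : nat) (rb : bitseq -> nat).

Definition closure_bits (b : bitseq) : bitseq :=
  mkseq (fun i => rb (add_bit b i) == rb b) (size b).

Definition flats : seq bitseq := [seq b <- bitseqs n.+1 | closure_bits b == b].

Definition outside (b : bitseq) : seq nat :=
  [seq i <- iota 0 n.+1 | ~~ nth false b i].

Definition join_pos (fl : seq bitseq) (b : bitseq) (i : nat) : nat :=
  index (closure_bits (add_bit b i)) fl.

(** The row at [b] computes the new value at the flat [b] from the old values at
the flats above it. *)
Definition lower_mx (i : nat) : sparse_mx :=
  let fl := flats in
  [seq if nth false b i then [::] else [:: (Zpos xH, join_pos fl b i)] | b <- fl].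

(** The average over the atoms outside a proper flat has between 1 and [n.+1]
terms, so this number clears its denominator. *)
Definition common_denominator : nat := foldr lcmn 1%N (iota 1 n.+1).

Definition D_mx : sparse_mx :=
  let fl := flats in
  [seq let c := (common_denominator %/ size (outside b))%N in
       [seq (Z.of_nat (c * rb (add_bit b i)), join_pos fl b i) | i <- outside b]
  | b <- fl].

Definition level_vec (r : nat) : seq Z :=
  [seq if rb b == r then 1 else 0 | b <- flats].

Variables (R : numFieldType) (M : matroid 'I_n.+1).
Hypothesis M_bits : forall X, M X = rb (bits X).
Implicit Types (x : flat M) (a : 'I_n.+1).

Definition pos x : nat := index (bits (flat_set x)) flats.

(** With this weight a list of values of [w] stands for the chain with
coefficients [beta x * w x]. *)
Definition weight x : R := (beta x)%:R.

Lemma bits_closure (X : {set 'I_n.+1}) :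
  bits (closure M X) = closure_bits (bits X).
Proof.
rewrite /closure_bits size_mkseq /bits.
apply/eq_in_map => i; rewrite mem_iota /= => lti.
by rewrite inE !M_bits bitsU1 inordK.
Qed.

Lemma bits_flat x : bits (flat_set x) \in flats.
Proof. by rewrite mem_filter bits_in -bits_closure (eqP (flatP x)) eqxx. Qed.

Lemma pos_lt x : (pos x < size flats)%N.
Proof. by rewrite index_mem bits_flat. Qed.

Lemma pos_onto p : (p < size flats)%N -> exists x, pos x = p.
Proof.
move=> ltp; have := mem_nth [::] ltp; set b := nth _ _ _.
rewrite mem_filter mem_bitseqs => /andP[/eqP clb /eqP sb].
have clX : closure M (unbits n b) == unbits n b.
  by rewrite -(inj_eq (can_inj (@bitsK n))) bits_closure unbitsK ?clb.
exists (Flat clX); rewrite /pos /= unbitsK // index_uniq //.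
by rewrite filter_uniq ?uniq_bitseqs.
Qed.

Lemma flat_joinE x a : (x `|` atom M a)%O = flat_closure M (a |: flat_set x).
Proof.
apply/eqP; rewrite eq_le leUx (flat_closure_le (a |: flat_set x)).
rewrite subUset sub1set -!atom_le.
rewrite leUr !atom_le (subsetP (sub_closure M _)) ?setU11 // andbT /=.
apply/andP; split; last exact: (leUl x (atom M a)).
by apply: subset_trans (sub_closure M _); apply: subsetUr.
Qed.

Lemma pos_join x a :
  pos (x `|` atom M a)%O = join_pos flats (bits (flat_set x)) a.
Proof. by rewrite /pos flat_joinE bits_closure bitsU1. Qed.

Lemma rk_join x a : rk (x `|` atom M a)%O = rb (add_bit (bits (flat_set x)) a).
Proof. by rewrite /rk flat_joinE mrank_closure M_bits bitsU1. Qed.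

Lemma row_dotE row v : row_dot row v = \sum_(t <- row) t.1 * entry v t.2.
Proof. by elim: row => [|t row IH]; rewrite ?big_nil // big_cons /= IH. Qed.

Lemma entry_flats (g : bitseq -> Z) x :
  entry [seq g b | b <- flats] (pos x) = g (bits (flat_set x)).
Proof.
by rewrite /entry (nth_map [::]) ?nth_index ?bits_flat // index_mem bits_flat.
Qed.

Local Notation toR z := ((int_of_Z z)%:~R : R).
Local Notation vec := (vec weight pos).

Lemma vec_lower a v : vec (apply_mx (lower_mx a) v) = lower R M a (vec v).
Proof.
apply/ffunP => x; rewrite lowerE !ffunE /apply_mx -map_comp entry_flats.
rewrite /= row_dotE nth_bits; case: ifP => _; first by rewrite big_nil mulr0.
rewrite big_seq1 -[Zpos xH]/(1 : Z) mul1r -pos_join /weight; congr (_ * _).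
by rewrite [RHS]mulrC mulKf ?beta_neq0.
Qed.

Lemma toR_nat k : toR (Z.of_nat k) = k%:R.
Proof. by rewrite (Z_of_intK (Posz k)). Qed.

Lemma outside_flat x : size (outside (bits (flat_set x))) = s_fun x.
Proof.
rewrite /s_fun -(cardsC [set a | (atom M a <= x)%O]) addKn.
rewrite -count_iota size_filter.
apply: eq_in_count => i; rewrite mem_iota => lti.
by rewrite nth_mkseq // !inE atom_le.
Qed.

Lemma dvdn_common_denominator d :
  (0 < d <= n.+1)%N -> (d %| common_denominator)%N.
Proof.
rewrite -[(d <= _)%N]/(d < 1 + n.+1)%N -mem_iota /common_denominator.
elim: (iota _ _) => //= e s IHs; rewrite inE => /predU1P[->|/IHs ds].
  exact: dvdn_lcml.
exact: dvdn_trans ds (dvdn_lcmr _ _).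
Qed.

Lemma common_denominator_gt0 : (0 < common_denominator)%N.
Proof.
rewrite /common_denominator; have : all (ltn 0) (iota 1 n.+1).
  by apply/allP => i; rewrite mem_iota => /andP[].
by elim: (iota _ _) => //= e s IHs /andP[e0 /IHs s0]; rewrite lcmn_gt0 e0.
Qed.

Lemma vec_D v :
  vec (apply_mx D_mx v) = common_denominator%:R *: D_beta R M (vec v).
Proof.
apply/ffunP => x; rewrite !ffunE D_betaE /apply_mx -map_comp entry_flats /=.
rewrite outside_flat row_dotE big_map big_filter /=.
have -> (F : nat -> Z) :
    \sum_(i <- iota 0 n.+1 | ~~ nth false (bits (flat_set x)) i) F i =
    \sum_(a | a \notin flat_set x) F a.
  rewrite -val_enum_ord big_map big_enum_cond.
  by apply: eq_bigl => a; rewrite nth_bits.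
(* At the top flat the average is over the empty set, and [S_inv] is 0. *)
case: eqP => [->|/eqP xtop].
  by rewrite big_pred0 => [|a]; rewrite ?inE // scaler0 mulr0.
have s_gt0 : (0 < s_fun x <= n.+1)%N.
  have -> : (s_fun x <= n.+1)%N.
    by apply: leq_trans (leq_subr _ _) _; rewrite card_ord.
  rewrite andbT subn_gt0.
  rewrite -cardsT proper_card // properEneq subsetT andbT.
  apply: contra xtop => /eqP topx; apply/eqP/val_inj/setP => a.
  have := in_setT a; rewrite -{1}topx inE atom_le => ->.
  by rewrite [RHS]in_setT.
rewrite rmorph_sum rmorph_sum !mulr_sumr /GRing.scale /= mulr_sumr.
apply: eq_bigr => a _.
rewrite !rmorphM /= !toR_nat (natf_div _ (dvdn_common_denominator s_gt0)).
rewrite -pos_join -rk_join !ffunE /weight.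
field; rewrite beta_neq0 pnatr_eq0 -lt0n.
by case/andP: s_gt0.
Qed.

Lemma vec_level r : vec (level_vec r) = vlevel R M r.
Proof.
apply/ffunP => x; rewrite ffunE entry_flats /vlevel sum_ffunE -M_bits.
rewrite -[M _]/(rk x); case: ifP => rx.
  rewrite mulr1 (bigD1 x) //= !ffunE eqxx big1 => [|y /andP[_ /negbTE yx]].
    by rewrite addr0 /GRing.scale /= mulr1.
  by rewrite !ffunE eq_sym yx scaler0.
rewrite mulr0 big1 // => y ry; rewrite !ffunE eq_sym.
by case: eqP => [yx|_]; [rewrite -yx ry in rx | rewrite scaler0].
Qed.

Definition lower_mxs : seq sparse_mx := [seq lower_mx i | i <- iota 0 n.+1].

Definition level_dims (ms : seq sparse_mx) (r : nat) : seq nat :=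
  [seq size B | B <- traject (next_basis (size flats) ms)
                       (echelon (size flats) [:: level_vec r]) r.+1].

Lemma nth_level_dims ms r k : (k < r.+1)%N ->
  nth 0%N (level_dims ms r) k =
  size (iter k (next_basis (size flats) ms)
         (echelon (size flats) [:: level_vec r])).
Proof.
move=> kr; rewrite (nth_map (echelon (size flats) [:: level_vec r])).
  by rewrite nth_traject.
by rewrite size_traject.
Qed.

Lemma H_zero_level_dims (d : seq nat) r :
  rank_of M = r -> level_dims lower_mxs r = d ->
  H_zero R M = \sum_(k < r.+1) (nth 0%N d k)%:R *: 'X^k.
Proof.
move=> <- <-; apply: eq_bigr => k _; congr (_%:R *: _).
rewrite nth_level_dims // /h_zero /lower_mxs -val_enum_ord -map_comp.
apply: (dim_levels (@beta_neq0 R _ M) pos_lt pos_onto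
          (f := lower R M) (m := fun i : 'I_n.+1 => lower_mx i)).
- by move=> a; exists 1; rewrite ?oner_neq0 // => v; rewrite vec_lower scale1r.
- by rewrite C_zero0 -vec_level.
- by move=> j; rewrite C_zeroS big_enum.
Qed.

Lemma H_beta_level_dims (d : seq nat) r :
  rank_of M = r -> level_dims (rcons lower_mxs D_mx) r = d ->
  H_beta R M = \sum_(k < r.+1) (nth 0%N d k)%:R *: 'X^k.
Proof.
move=> <- <-; apply: eq_bigr => k _; congr (_%:R *: _).
rewrite nth_level_dims // /h_beta /lower_mxs -val_enum_ord -map_comp.
pose m (o : option 'I_n.+1) := if o is Some i then lower_mx i else D_mx.
pose f o := if o is Some i then lower R M i else D_beta R M.
have -> : rcons (map (lower_mx \o val) (enum 'I_n.+1)) D_mx =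
          map m (rcons (map Some (enum 'I_n.+1)) None).
  by rewrite map_rcons -[map m _]map_comp.
apply: (dim_levels (@beta_neq0 R _ M) pos_lt pos_onto (f := f)).
- case=> [a|]; last exists common_denominator%:R.
  + by exists 1; rewrite ?oner_neq0 // => v; rewrite vec_lower scale1r.
  + by rewrite pnatr_eq0 -lt0n common_denominator_gt0.
  + exact: vec_D.
- by rewrite /= -vec_level.
- by move=> j; rewrite -cats1 big_cat big_seq1 big_map big_enum; apply: addvC.
Qed.

End Levels.

(** * Tallies of jump sequences *)

Section Orderings.
Variables (E : finType) (M : matroid E).
Implicit Types (X : {set E}) (s : seq E).

Fixpoint jumps_from X s : seq nat :=
  if s is e :: s' then (M (e |: X) - M X)%N :: jumps_from (e |: X) s' else [::].

Lemma rank_jumpsE s : rank_jumps M s = jumps_from set0 s.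
Proof.
pose after X (t : seq E) := X :|: [set e in t].
suff jE X : [seq (M (after X (take i.+1 s)) - M (after X (take i s)))%N
            | i <- iota 0 (size s)] = jumps_from X s.
  by rewrite -jE; apply: eq_map => i; rewrite /after !set0U.
elim: s X => //= e s IHs X; rewrite -IHs (iotaDl 1) -map_comp /=.
have afterC t : after X (e :: t) = after (e |: X) t.
  by rewrite /after set_cons setUCA setUA.
congr (_ :: _); last by apply: eq_map => i; rewrite /= !afterC.
by rewrite !afterC take0 /after set_nil !setU0.
Qed.

Fixpoint orderings k X : seq (seq E) :=
  if k is k'.+1 then [seq e :: s | e <- enum (~: X), s <- orderings k' (e |: X)]
  else [:: [::]].

Lemma mem_orderings k X s :
  (s \in orderings k X) = [&& size s == k, uniq s & all (mem (~: X)) s].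
Proof.
elim: k X s => [|k IHk] X [|e s] //=; first by apply/allpairsPdep => -[? [? []]].
rewrite eqSS; apply/allpairsPdep/idP => [[e0 [s0 [+ + [-> ->]]]]|].
  rewrite mem_enum IHk => eX /and3P[-> us /allP sX].
  rewrite us eX andbT /=; apply/andP; split.
    by apply/negP => es; have := sX _ es; rewrite /= !inE eqxx.
  by apply/allP => x xs; have := sX _ xs; rewrite /= !inE negb_or => /andP[].
case/and3P=> sk /andP[es us] /andP[eX /allP sX]; exists e, s; split => //.
  by rewrite mem_enum.
rewrite IHk sk us; apply/allP => x xs.
have := sX _ xs; rewrite !inE negb_or => ->.
by rewrite andbT; apply: contraNneq es => <-.
Qed.

Lemma uniq_orderings k X : uniq (orderings k X).
Proof.
elim: k X => //= k IHk X; apply: allpairs_uniq_dep; rewrite ?enum_uniq //.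
by move=> [e s] [e' s'] _ _ /= [-> ->].
Qed.

Lemma sum_orderings (A : nmodType) (F : seq nat -> A) k :
  \sum_(p : k.-tuple E | uniq p) F (rank_jumps M p) =
  \sum_(s <- orderings k set0) F (jumps_from set0 s).
Proof.
rewrite -(big_map val uniq (fun s => F (rank_jumps M s))).
rewrite -big_filter [LHS](perm_big (orderings k set0)) /=.
  by apply: eq_bigr => s _; rewrite rank_jumpsE.
apply: uniq_perm; rewrite ?uniq_orderings //.
  by rewrite filter_uniq // map_inj_uniq ?index_enum_uniq //; apply: val_inj.
move=> s; rewrite mem_filter mem_orderings [RHS]andbCA; congr (_ && _).
have -> : all (mem (~: set0)) s by apply/allP => x _; rewrite !inE.
rewrite andbT; apply/mapP/idP => [[p _ ->]|sk]; first by rewrite size_tuple.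
by exists (Tuple sk); rewrite ?mem_index_enum.
Qed.

End Orderings.

(** A binary tree with one leaf for each bit sequence of length [n]: the
recursion over subsets stores its values there, so that each subset is treated
once for every length and not once for every ordering leading to it. *)
Inductive bit_table (A : Type) :=
  TableLeaf of A | TableNode of bit_table A & bit_table A.

Fixpoint tabulate (A : Type) (n : nat) (f : bitseq -> A) : bit_table A :=
  if n is m.+1 then
    TableNode (tabulate m (fun b => f (true :: b)))
              (tabulate m (fun b => f (false :: b)))
  else TableLeaf (f [::]).

Fixpoint lookup (A : Type) (x0 : A) (t : bit_table A) (b : bitseq) : A :=
  match t, b with
  | TableLeaf x, [::] => x
  | TableNode t1 t0, c :: b' => lookup x0 (if c then t1 else t0) b'
  | _, _ => x0
  end.

Lemma lookup_tabulate (A : Type) (x0 : A) n f b :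
  size b = n -> lookup x0 (tabulate n f) b = f b.
Proof. by elim: n b f => [|n IHn] [|[] b] f //= [sb]; rewrite IHn. Qed.

(** The orderings fall on very few distinct jump sequences, so a plain list of
sequences with multiplicities stays short. *)
Definition tally := seq (seq nat * nat).

Fixpoint add_count (s : seq nat) (c : nat) (t : tally) : tally :=
  if t is (s', c') :: t' then
    if s == s' then (s', (c + c')%N) :: t' else (s', c') :: add_count s c t'
  else [:: (s, c)].

Definition add_shifted (j : nat) (t acc : tally) : tally :=
  foldr (fun sc => add_count (j :: sc.1) sc.2) acc t.

Section TallySum.
Variable A : nmodType.
Implicit Types (F : seq nat -> A) (t : tally).

Definition tally_sum F t : A := \sum_(sc <- t) F sc.1 *+ sc.2.

Lemma tally_sum_add_count F s c t :
  tally_sum F (add_count s c t) = F s *+ c + tally_sum F t.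
Proof.
rewrite /tally_sum; elim: t => [|[s' c'] t IHt] /=.
  by rewrite big_seq1 big_nil addr0.
case: eqP => [->|_]; rewrite !big_cons /=; first by rewrite mulrnDr addrA.
by rewrite IHt addrCA.
Qed.

Lemma tally_sum_add_shifted F j t acc :
  tally_sum F (add_shifted j t acc) =
  tally_sum (fun s => F (j :: s)) t + tally_sum F acc.
Proof.
elim: t => [|sc t IHt] /=; first by rewrite /tally_sum big_nil add0r.
by rewrite tally_sum_add_count IHt addrA /tally_sum [in RHS]big_cons.
Qed.

End TallySum.

Section Tallies.
Variables (n : nat) (rb : bitseq -> nat).

Fixpoint tally_table (k : nat) : bit_table tally :=
  if k is k'.+1 then
    let table := tally_table k' in
    tabulate n.+1 (fun b =>
      foldr (fun i => add_shifted (rb (add_bit b i) - rb b)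
                                  (lookup [::] table (add_bit b i)))
        [::] (outside n b))
  else tabulate n.+1 (fun=> [:: ([::], 1%N)]).

Definition jump_tally : tally :=
  lookup [::] (tally_table n.+1) (nseq n.+1 false).

Variable M : matroid 'I_n.+1.
Hypothesis M_bits : forall X, M X = rb (bits X).

Lemma outside_bits (X : {set 'I_n.+1}) :
  outside n (bits X) = map val (enum (~: X)).
Proof.
rewrite /outside -val_enum_ord filter_map {1}enumT; congr map.
by apply: eq_filter => i; rewrite /= nth_bits inE.
Qed.

Lemma tally_sum_table (A : nmodType) (F : seq nat -> A) k X :
  tally_sum F (lookup [::] (tally_table k) (bits X)) =
  \sum_(s <- orderings k X) F (jumps_from M X s).
Proof.
elim: k X F => [|k IHk] X F; rewrite lookup_tabulate ?size_mkseq //.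
  by rewrite /tally_sum !big_seq1 mulr1n.
rewrite outside_bits big_allpairs_dep /=.
elim: (enum _) => [|e s IHs]; first by rewrite /tally_sum !big_nil.
rewrite big_cons -IHs /= tally_sum_add_shifted; congr (_ + _).
by rewrite -bitsU1 -!M_bits IHk.
Qed.

Lemma sum_rank_jumps (A : nmodType) (F : seq nat -> A) :
  \sum_(p : #|'I_n.+1|.-tuple 'I_n.+1 | uniq p) F (rank_jumps M p) =
  tally_sum F jump_tally.
Proof. by rewrite sum_orderings -tally_sum_table card_ord bits0. Qed.

End Tallies.

Lemma G_invariant_eq (n m : nat) (rP rQ : bitseq -> nat)
    (P : matroid 'I_n.+1) (Q : matroid 'I_m.+1) :
  (forall X, P X = rP (bits X)) -> (forall X, Q X = rQ (bits X)) ->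
  perm_eq (jump_tally n rP) (jump_tally m rQ) -> G_invariant P = G_invariant Q.
Proof.
move=> hP hQ PQ; rewrite /G_invariant.
rewrite (sum_rank_jumps hP (fun s => << s >>)).
rewrite (sum_rank_jumps hQ (fun s => << s >>)).
exact: perm_big.
Qed.

(** * Matroids given by a rank function on bits *)

Section MatroidOfBits.
Variables (n : nat) (rb : bitseq -> nat).

Definition rank_axioms : bool :=
  let bs := [seq (b, rb b) | b <- bitseqs n.+1] in
  all (fun p => (p.2 <= count id p.1)%N &&
    all (fun q => (all id (bits_op implb p.1 q.1) ==> (p.2 <= q.2)%N) &&
      (rb (bits_op orb p.1 q.1) + rb (bits_op andb p.1 q.1) <= p.2 + q.2)%N)
      bs) bs.

Hypothesis rbP : rank_axioms.

Let rank (X : {set 'I_n.+1}) := rb (bits X).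

Let axiomsP (X Y : {set 'I_n.+1}) :
  [/\ (rank X <= count id (bits X))%N,
      all id (bits_op implb (bits X) (bits Y)) -> (rank X <= rank Y)%N
    & (rb (bits_op orb (bits X) (bits Y)) + rb (bits_op andb (bits X) (bits Y)) <=
       rank X + rank Y)%N].
Proof.
have inb (Z : {set 'I_n.+1}) :
    (bits Z, rank Z) \in [seq (b, rb b) | b <- bitseqs n.+1].
  by apply/mapP; exists (bits Z); rewrite ?bits_in.
have /andP[-> /allP/(_ _ (inb Y))/andP[/implyP sXY UI]] := allP rbP _ (inb X).
by split.
Qed.

Fact rank_card X : (rank X <= #|X|)%N.
Proof.
have [+ _ _] := axiomsP X X; rewrite -(count_iota X) /bits /mkseq count_map.
by apply: leq_trans; rewrite leq_eqVlt eqxx.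
Qed.

Fact rankS (X Y : {set 'I_n.+1}) : X \subset Y -> (rank X <= rank Y)%N.
Proof.
move=> /subsetP sXY; have [_ + _] := axiomsP X Y; apply.
rewrite -bits_map2; apply/(all_nthP false) => i; rewrite size_mkseq => lti.
by rewrite nth_mkseq // inE; apply/implyP/sXY.
Qed.

Fact rankUI (X Y : {set 'I_n.+1}) :
  (rank (X :|: Y) + rank (X :&: Y) <= rank X + rank Y)%N.
Proof.
have [_ _] := axiomsP X Y; rewrite -!bits_map2; apply: etrans.
by congr (rank _ + rank _ <= _)%N; apply/setP => i; rewrite !inE.
Qed.

Definition matroid_of_bits : matroid 'I_n.+1 := Matroid rank_card rankS rankUI.

Definition simple_bits : bool :=
  let o := nseq n.+1 false in
  all (fun i => (rb (add_bit o i) == 1%N) &&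
    all (fun j => (i != j) ==> (rb (add_bit (add_bit o j) i) == 2%N))
        (iota 0 n.+1))
  (iota 0 n.+1).

Lemma simple_matroid_of_bits : simple_bits -> simple_matroid matroid_of_bits.
Proof.
move=> /allP sb; have ini (i : 'I_n.+1) : val i \in iota 0 n.+1.
  by rewrite mem_iota ltn_ord.
split=> [a|a b ab]; have /andP[/eqP r1 /allP r2] := sb _ (ini a).
  by rewrite -r1 -bits0 -bitsU1 setU0.
have /implyP/(_ ab)/eqP <- := r2 _ (ini b).
by rewrite -bits0 -!bitsU1 setU0.
Qed.

Lemma rank_of_bits : rank_of matroid_of_bits = rb (nseq n.+1 true).
Proof. by rewrite -bitsT. Qed.

End MatroidOfBits.

(** * The two matroids *)

(** Three distinct points span the plane unless one of the given lines contains
the whole list; repetitions in the list are parallel elements. *)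
Definition config_rank (lines : seq (seq nat)) (pts : seq nat) : nat :=
  minn (size (undup pts)) (if has (fun l => all (mem l) pts) lines then 2 else 3).

(** This is the formula [#|X| + r (~: X) - r E] for the dual rank, where
[r E = 3]; the [i]-th element of the ground set is the point [nth 0 labels i]. *)
Definition dual_rank lines labels (b : bitseq) : nat :=
  (count id b + config_rank lines (mask (map negb b) labels) - 3)%N.

Definition rank_P : bitseq -> nat :=
  dual_rank [:: [:: 0; 1; 2]; [:: 3; 4; 5]]%N [:: 0; 1; 2; 2; 3; 4; 5; 5]%N.

Definition rank_Q : bitseq -> nat :=
  dual_rank [:: [:: 0; 1; 2]; [:: 0; 3; 4]]%N [:: 0; 0; 1; 2; 3; 4; 5; 5]%N.

(** The parameter 7 stands for the ground set ['I_8]. *)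
Lemma rank_axioms_P : rank_axioms 7 rank_P.
Proof. by vm_compute. Qed.

Lemma rank_axioms_Q : rank_axioms 7 rank_Q.
Proof. by vm_compute. Qed.

Lemma jump_tally_PQ : perm_eq (jump_tally 7 rank_P) (jump_tally 7 rank_Q).
Proof. by vm_compute. Qed.

Lemma zero_dims_P :
  level_dims 7 rank_P (lower_mxs 7 rank_P) 5 = [:: 1; 8; 25; 25; 8; 1]%N.
Proof. by vm_compute. Qed.

Lemma zero_dims_Q :
  level_dims 7 rank_Q (lower_mxs 7 rank_Q) 5 = [:: 1; 8; 25; 25; 8; 1]%N.
Proof. by vm_compute. Qed.

Lemma beta_dims_P :
  level_dims 7 rank_P (rcons (lower_mxs 7 rank_P) (D_mx 7 rank_P)) 5 =
  [:: 1; 9; 30; 25; 8; 1]%N.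
Proof. by vm_compute. Qed.

Lemma beta_dims_Q :
  level_dims 7 rank_Q (rcons (lower_mxs 7 rank_Q) (D_mx 7 rank_Q)) 5 =
  [:: 1; 9; 28; 25; 8; 1]%N.
Proof. by vm_compute. Qed.

Theorem theorem1 (R : realType) :
  exists (E F : finType) (P : matroid E) (Q : matroid F),
    (simple_matroid P /\ rank_of P = 5%N) /\
    (simple_matroid Q /\ rank_of Q = 5%N) /\
    G_invariant P = G_invariant Q /\
    H_zero R P = H_zero R Q /\
    H_beta R P =
      1 + 9 *: 'X + 30 *: 'X^2 + 25 *: 'X^3 + 8 *: 'X^4 + 'X^5 /\
    H_beta R Q =
      1 + 9 *: 'X + 28 *: 'X^2 + 25 *: 'X^3 + 8 *: 'X^4 + 'X^5 /\
    H_zero R P =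
      1 + 8 *: 'X + 25 *: 'X^2 + 25 *: 'X^3 + 8 *: 'X^4 + 'X^5 /\
    H_zero R Q =
      1 + 8 *: 'X + 25 *: 'X^2 + 25 *: 'X^3 + 8 *: 'X^4 + 'X^5.
Proof.
pose P := matroid_of_bits rank_axioms_P; pose Q := matroid_of_bits rank_axioms_Q.
have rP : rank_of P = 5%N by rewrite rank_of_bits.
have rQ : rank_of Q = 5%N by rewrite rank_of_bits.
have P_bits X : P X = rank_P (bits X) by [].
have Q_bits X : Q X = rank_Q (bits X) by [].
have HP0 := H_zero_level_dims R P_bits rP zero_dims_P.
have HQ0 := H_zero_level_dims R Q_bits rQ zero_dims_Q.
have HPb := H_beta_level_dims R P_bits rP beta_dims_P.
have HQb := H_beta_level_dims R Q_bits rQ beta_dims_Q.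
exists _, _, P, Q.
split; first by split=> //; apply: simple_matroid_of_bits; vm_compute.
split; first by split=> //; apply: simple_matroid_of_bits; vm_compute.
split; first exact: G_invariant_eq P_bits Q_bits jump_tally_PQ.
rewrite HP0 HQ0 HPb HQb; split=> //.
by rewrite !big_ord_recr !big_ord0 /= !add0r expr0 expr1 !scale1r.
Qed.
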